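(* Let $K$ be a field, $Q$ a finite quiver, $\succ$ a length admissible order on the set $\mathcal B$ of paths of $Q$, and let $\mathcal T$ be a set of paths of length $2$ in $Q$. There is a one-to-one correspondence, given by $X\mapsto KQ/\langle \mathcal G(X)\rangle$, between the points $X$ of $\mathrm{GrAlg}(\mathcal T)$ and the algebras $KQ/I$ ($I$ an ideal of $KQ$) that are strong Koszul algebras (with respect to $I$ and $\succ$) such that $\langle \mathcal T\rangle=\langle \mathrm{tip}(I)\rangle$. (Here algebras $KQ/I$ and $KQ/I'$ are regarded as the same exactly when $I=I'$.)
   Context: $KQ$ is the path algebra, $\mathcal B$ the set of all finite directed paths in $Q$ (vertices are paths of length $0$), $\ell(p)$ the length of a path; paths are written left to right, so a path $p$ from $v$ to $w$ satisfies $vpw=p$. ''Ideal'' means two-sided ideal and $\langle X\rangle$ is the two-sided ideal generated by $X$. A length admissible order is a well-order $\succ$ on $\mathcal B$ such that for $p,q,r,s,t\in\mathcal B$: $p\succ q$ implies $pr\succ qr$ if both are nonzero; $p\succ q$ implies $sp\succ sq$ if both are nonzero; $p=rqt$ implies $p\succeq q$; and $\ell(p)>\ell(q)$ implies $p\succ q$. For nonzero $x=\sum_{p\in\mathcal B}\alpha_p p\in KQ$, $\mathrm{tip}(x)$ is the $\succ$-largest $p$ with $\alpha_p\neq 0$; for $X\subseteq KQ$, $\mathrm{tip}(X)=\{\mathrm{tip}(x): x\in X, x\ne 0\}$. A nonzero $x$ is uniform if $x=vxw$ for some vertices $v,w$; an element is quadratic if it is a $K$-linear combination of paths of length $2$.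 An ideal is graded if it is generated by length homogeneous elements. A Gröbner basis of a graded ideal $I$ is a set $\mathcal G\subseteq I$ of length homogeneous uniform elements with $\langle\mathrm{tip}(\mathcal G)\rangle=\langle \mathrm{tip}(I)\rangle$. $KQ/I$ is a strong Koszul algebra (with respect to $I$ and $\succ$) if $I$ has a Gröbner basis with respect to $\succ$ consisting of quadratic elements. Given $\mathcal T$: $\mathcal N=\mathcal B\setminus \mathrm{tip}(\langle\mathcal T\rangle)$ (the paths having no subpath in $\mathcal T$); $\mathcal N_2$ is the set of paths of length $2$ in $\mathcal N$; for $t\in\mathcal T$, $\mathcal N_2(t)$ is the set of $n\in\mathcal N_2$ with $t\succ n$ and $n$ having the same start vertex and the same end vertex as $t$. Put $D=\sum_{t\in\mathcal T}|\mathcal N_2(t)|$ and $\mathcal A=K^D$, with points written $X=(x_{t,n})_{t\in\mathcal T,\,n\in\mathcal N_2(t)}$. For $X\in\mathcal A$, $\mathcal G(X)=\{g_t : t\in\mathcal T\}$ with $g_t=t-\sum_{n\in\mathcal N_2(t)}x_{t,n}n$. Finally $\mathrm{GrAlg}(\mathcal T)=\{X\in\mathcal A : KQ/\langle \mathcal G(X)\rangle$ is a strong Koszul algebra with respect to $\langle\mathcal G(X)\rangle$ and $\succ\}$. *)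

(* Defs.v *)
From HB Require Import structures.
From mathcomp Require Import all_boot all_order all_algebra finmap.
From mathcomp Require Import boolp classical_sets functions wochoice.
From mathcomp Require Import monalg.

Set Implicit Arguments.
Unset Strict Implicit.
Unset Printing Implicit Defensive.

Import GRing.Theory.

Local Open Scope classical_set_scope.
Local Open Scope ring_scope.

Record quiver := Quiver {
  vertex : finType;
  arrow : finType;
  source : arrow -> vertex;
  target : arrow -> vertex }.

Section Paths.
Variable Q : quiver.

Fixpoint walk (v : vertex Q) (s : seq (arrow Q)) : bool :=
  if s is a :: s' then (source a == v) && walk (target a) s' else true.

(* The start vertex is stored so that paths of length 0 are the vertices. *)
Record qpath := QPath {
  qpath_val : vertex Q * seq (arrow Q);
  _ : walk qpath_val.1 qpath_val.2 }.

HB.instance Definition _ := [isSub for qpath_val].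
HB.instance Definition _ := [Choice of qpath by <:].

Definition start (p : qpath) : vertex Q := (val p).1.
Definition arrows (p : qpath) : seq (arrow Q) := (val p).2.
Definition finish (p : qpath) : vertex Q :=
  last (start p) [seq target a | a <- arrows p].
Definition plength (p : qpath) : nat := size (arrows p).

Definition vpath (v : vertex Q) : qpath := @QPath (v, [::]) isT.

(* Left-to-right composition; None stands for the zero product. When the
   endpoints match the insub always succeeds (concat_Some). *)
Definition concat (p q : qpath) : option qpath :=
  if finish p == start q then insub (start p, arrows p ++ arrows q) else None.

Lemma walk_cat v s1 s2 :
  walk v (s1 ++ s2) =
  walk v s1 && walk (last v [seq target a | a <- s1]) s2.
Proof. by elim: s1 v => [//|a s1 IH] v /=; rewrite IH andbA. Qed.

Lemma concat_Some p q : finish p = start q ->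
  exists r, [/\ concat p q = Some r, start r = start p &
                arrows r = arrows p ++ arrows q].
Proof.
move=> epq; have wpq : walk (start p) (arrows p ++ arrows q).
  by rewrite walk_cat (valP p) /=; move: (valP q); rewrite -/(start q) -epq.
exists (@QPath (start p, arrows p ++ arrows q) wpq).
split=> //; rewrite /concat epq eqxx.
by case: insubP => [u _ eu|]; [congr Some; apply: val_inj | rewrite wpq].
Qed.

Lemma concat_SomeE p q r : concat p q = Some r ->
  [/\ finish p = start q, start r = start p &
      arrows r = arrows p ++ arrows q].
Proof.
rewrite /concat; case: eqP => // epq; case: insubP => // u _ eu [<-].
by rewrite /start /arrows eu.
Qed.

Lemma qpath_eq p q : start p = start q -> arrows p = arrows q -> p = q.
Proof.
by rewrite /start /arrows => e1 e2; apply: val_inj;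
   case: (val p) (val q) e1 e2 => ? ? [? ?] /= -> ->.
Qed.

Lemma finish_concat p q r : concat p q = Some r -> finish r = finish q.
Proof.
case/concat_SomeE => e1 e2 e3.
by rewrite /finish e2 e3 map_cat last_cat -/(finish p) e1.
Qed.

Lemma concatA p q r :
  obind (concat p) (concat q r) = obind (concat^~ r) (concat p q).
Proof.
have [eqr|nqr] := eqVneq (finish q) (start r); last first.
  have -> : concat q r = None by rewrite /concat (negbTE nqr).
  case epq: (concat p q) => [u|] //=.
  by rewrite /concat (finish_concat epq) (negbTE nqr).
have [u [eu su au]] := concat_Some eqr; rewrite eu /=.
have [epq|npq] := eqVneq (finish p) (start q); last first.
  have -> : concat p q = None by rewrite /concat (negbTE npq).
  by rewrite /concat su (negbTE npq).
have [w [ew sw aw]] := concat_Some epq; rewrite ew /=.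
have [x [-> sx ax]] := concat_Some (etrans epq (esym su)).
have [y [-> sy ay]] := concat_Some (etrans (finish_concat ew) eqr).
congr Some; apply: qpath_eq; first by rewrite sx sy.
by rewrite ax ay au aw catA.
Qed.

Lemma concat_vl v p : concat (vpath v) p = if v == start p then Some p else None.
Proof.
case: (eqVneq v (start p)) => [e|n]; last by rewrite /concat /finish /= (negbTE n).
have [r [-> s a]] := @concat_Some (vpath v) p e.
by congr Some; apply: qpath_eq; rewrite ?a // s.
Qed.

Lemma concat_vr v p : concat p (vpath v) = if v == finish p then Some p else None.
Proof.
case: (eqVneq v (finish p)) => [e|n]; last first.
  by rewrite /concat /= eq_sym (negbTE n).
have [r [-> s a]] := @concat_Some p (vpath v) (esym e).
by congr Some; apply: qpath_eq; rewrite // a cats0.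
Qed.

Definition path2 := {p : qpath | plength p == 2}.

Definition path2_tuple (p : path2) : 2.-tuple (arrow Q) := Tuple (valP p).
Definition tuple_path2 (t : 2.-tuple (arrow Q)) : option path2 :=
  obind insub (insub (source (tnth t ord0), val t)).

Lemma path2_tupleK : pcancel path2_tuple tuple_path2.
Proof.
move=> p; rewrite /tuple_path2.
have -> : (source (tnth (path2_tuple p) ord0), val (path2_tuple p)) =
          val (val p).
  case: p => -[[v s] w] h; set p := exist _ _ _.
  rewrite (tnth_nth (tnth (path2_tuple p) ord0)) /=.
  move: (tnth _ _) => a0; move: h {p}; rewrite /plength /arrows /=.
  by case: s w => [|a s] //= /andP[/eqP -> _] _.
by rewrite valK /= valK.
Qed.

HB.instance Definition _ := Choice.on path2.
HB.instance Definition _ : isCountable path2 := PCanIsCountable path2_tupleK.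
HB.instance Definition _ : isFinite path2 := PCanIsFinite path2_tupleK.

End Paths.

Section PathAlgebra.
Variables (K : fieldType) (Q : quiver).

Definition path_algebra := {malg K[qpath Q]}.

HB.instance Definition _ := GRing.Lmodule.on path_algebra.

Implicit Types (x y z : path_algebra) (p q r : qpath Q).

Definition pvec p : path_algebra := << p >>.

Definition pvec_opt (o : option (qpath Q)) : path_algebra := oapp pvec 0 o.

Definition pamul x y : path_algebra :=
  \sum_(p <- msupp x) \sum_(q <- msupp y)
     (x@_p * y@_q) *: pvec_opt (concat p q).

(* The vertices form a complete set of orthogonal idempotents. *)
Definition paone : path_algebra := \sum_(v : vertex Q) pvec (vpath v).

Lemma pacoeffZ (c : K) x p : (c *: x)@_p = c * x@_p.
Proof. exact: mcoeffZ. Qed.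

Lemma pvecE p q : (pvec p)@_q = (p == q)%:R.
Proof. exact: mcoeffU. Qed.

Lemma pvec_sum x : x = \sum_(p <- msupp x) x@_p *: pvec p.
Proof.
rewrite {1}[x]monalgE; apply: eq_bigr => p _; apply/malgP => k.
by rewrite mcoeffU pacoeffZ pvecE mulr_natr.
Qed.

Lemma pamulEw x y (A B : {fset qpath Q}) :
  (msupp x `<=` A)%fset -> (msupp y `<=` B)%fset ->
  pamul x y = \sum_(p <- A) \sum_(q <- B)
     (x@_p * y@_q) *: pvec_opt (concat p q).
Proof.
move=> sA sB; rewrite /pamul (big_fset_incl _ sA) /=; last first.
  move=> p _ /mcoeff_outdom e; rewrite big1 // => q _.
  by rewrite e mul0r scale0r.
apply: eq_bigr => p _; rewrite (big_fset_incl _ sB) //= => q _ /mcoeff_outdom e.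
by rewrite e mulr0 scale0r.
Qed.

Lemma pamulDl : left_distributive pamul +%R.
Proof.
move=> x y z; pose A := (msupp x `|` msupp y)%fset.
rewrite (@pamulEw (x + y) z A (msupp z)) ?msuppD_le //.
rewrite (@pamulEw x z A (msupp z)) ?fsubsetUl //.
rewrite (@pamulEw y z A (msupp z)) ?fsubsetUr //.
rewrite -big_split; apply: eq_bigr => p _; rewrite -big_split.
by apply: eq_bigr => q _; rewrite mcoeffD mulrDl scalerDl.
Qed.

Lemma pamulDr : right_distributive pamul +%R.
Proof.
move=> z x y; pose A := (msupp x `|` msupp y)%fset.
rewrite (@pamulEw z (x + y) (msupp z) A) ?msuppD_le //.
rewrite (@pamulEw z x (msupp z) A) ?fsubsetUl //.
rewrite (@pamulEw z y (msupp z) A) ?fsubsetUr //.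
rewrite -big_split; apply: eq_bigr => p _; rewrite -big_split.
by apply: eq_bigr => q _; rewrite mcoeffD mulrDr scalerDl.
Qed.

Lemma pamulZl c x y : pamul (c *: x) y = c *: pamul x y.
Proof.
rewrite (@pamulEw (c *: x) y (msupp x) (msupp y)) ?msuppZ_le //.
rewrite /pamul scaler_sumr; apply: eq_bigr => p _; rewrite scaler_sumr.
by apply: eq_bigr => q _; rewrite mcoeffZ scalerA mulrA.
Qed.

Lemma pamulZr c x y : pamul x (c *: y) = c *: pamul x y.
Proof.
rewrite (@pamulEw x (c *: y) (msupp x) (msupp y)) ?msuppZ_le //.
rewrite /pamul scaler_sumr; apply: eq_bigr => p _; rewrite scaler_sumr.
by apply: eq_bigr => q _; rewrite mcoeffZ scalerA mulrCA.
Qed.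

Lemma pamul_pvec p q : pamul (pvec p) (pvec q) = pvec_opt (concat p q).
Proof.
rewrite (@pamulEw _ _ [fset p]%fset [fset q]%fset) ?msuppU_le //.
by rewrite !big_seq_fset1 !mcoeffUU mulr1 scale1r.
Qed.

Lemma pamul0 x : pamul 0 x = 0.
Proof. by have := pamulZl 0 0 x; rewrite !scale0r. Qed.

Lemma pamul_0r x : pamul x 0 = 0.
Proof. by have := pamulZr 0 x 0; rewrite !scale0r. Qed.

Lemma pamul_suml (I : Type) (s : seq I) (F : I -> path_algebra) y :
  pamul (\sum_(i <- s) F i) y = \sum_(i <- s) pamul (F i) y.
Proof.
exact: (big_morph (pamul^~ y) (fun a b => pamulDl a b y) (pamul0 y)).
Qed.

Lemma pamul_sumr (I : Type) (s : seq I) (F : I -> path_algebra) y :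
  pamul y (\sum_(i <- s) F i) = \sum_(i <- s) pamul y (F i).
Proof. exact: (big_morph (pamul y) (pamulDr y) (pamul_0r y)). Qed.

Lemma pamulEl x y : pamul x y = \sum_(p <- msupp x) x@_p *: pamul (pvec p) y.
Proof.
rewrite {1}(pvec_sum x) pamul_suml.
by apply: eq_bigr => p _; rewrite pamulZl.
Qed.

Lemma pamulEr x y : pamul x y = \sum_(q <- msupp y) y@_q *: pamul x (pvec q).
Proof.
rewrite {1}(pvec_sum y) pamul_sumr.
by apply: eq_bigr => q _; rewrite pamulZr.
Qed.

Lemma pamulA : associative pamul.
Proof.
move=> x y z; rewrite (pamulEl x (pamul y z)) (pamulEl x y) pamul_suml.
apply: eq_bigr => p _; rewrite [RHS]pamulZl; congr (_ *: _).
rewrite (pamulEl y z) (pamulEr (pvec p) y) pamul_suml pamul_sumr.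
apply: eq_bigr => q _; rewrite [LHS]pamulZr [RHS]pamulZl; congr (_ *: _).
rewrite (pamulEr (pvec q) z) (pamulEr (pamul (pvec p) (pvec q)) z) pamul_sumr.
apply: eq_bigr => r _; rewrite [LHS]pamulZr; congr (_ *: _).
rewrite (pamul_pvec q r) (pamul_pvec p q).
have := concatA p q r.
case: (concat q r) => [u|]; case: (concat p q) => [w|] /= e.
- by rewrite (pamul_pvec p u) (pamul_pvec w r) e.
- by rewrite (pamul_pvec p u) pamul0 e.
- by rewrite (pamul_pvec w r) pamul_0r -e.
- by rewrite pamul0 pamul_0r.
Qed.

Lemma pamul1l : left_id paone pamul.
Proof.
move=> x; rewrite (pamulEr paone x) [RHS]pvec_sum.
apply: eq_bigr => p _; congr (_ *: _).
rewrite /paone pamul_suml (bigD1 (start p)) //= big1 => [|v nv].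
  by rewrite pamul_pvec concat_vl eqxx addr0.
by rewrite pamul_pvec concat_vl (negbTE nv).
Qed.

Lemma pamul1r : right_id paone pamul.
Proof.
move=> x; rewrite (pamulEl x paone) [RHS]pvec_sum.
apply: eq_bigr => p _; congr (_ *: _).
rewrite /paone pamul_sumr (bigD1 (finish p)) //= big1 => [|v nv].
  by rewrite pamul_pvec concat_vr eqxx addr0.
by rewrite pamul_pvec concat_vr (negbTE nv).
Qed.

(* Possibly the zero ring, when Q has no vertex. *)
HB.instance Definition _ := GRing.Zmodule_isPzRing.Build path_algebra
  pamulA pamul1l pamul1r pamulDl pamulDr.

Lemma pvecM p q : pvec p * pvec q = pvec_opt (concat p q).
Proof. exact: pamul_pvec. Qed.

Lemma pascalerAl (c : K) x y : c *: (x * y) = (c *: x) * y.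
Proof. by rewrite -[RHS]/(pamul _ _) pamulZl. Qed.

Lemma pascalerAr (c : K) x y : c *: (x * y) = x * (c *: y).
Proof. by rewrite -[RHS]/(pamul _ _) pamulZr. Qed.

End PathAlgebra.

Section Ideals.
Variable R : pzRingType.

(* For R = path_algebra K Q such a set is also closed under scaling by K,
   since c *: x = (c *: 1) * x. *)
Record is_ideal (I : set R) : Prop := IsIdeal {
  ideal0 : I 0;
  idealD : forall x y, I x -> I y -> I (x + y);
  idealMl : forall a x, I x -> I (a * x);
  idealMr : forall a x, I x -> I (x * a) }.

Definition ideal_gen (X : set R) : set R := smallest is_ideal X.

Lemma ideal_gen_ideal (X : set R) : is_ideal (ideal_gen X).
Proof.
split=> [I [[]]//|x y hx hy I hI|a x hx I hI|a x hx I hI]; case: (hI) => -[] *.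
- by have := hx I hI; have := hy I hI; auto.
- by have := hx I hI; auto.
- by have := hx I hI; auto.
Qed.

End Ideals.

Section Order.
Variable Q : quiver.
Implicit Types (le : rel (qpath Q)) (p q r s t : qpath Q).

(* le p q is the reflexive order "q succeeds or equals p"; psucc le p q is the
   strict relation "p succeeds q". *)
Definition psucc le p q : bool := (p != q) && le q p.

Record length_admissible le : Prop := LengthAdmissible {
  la_well_order : wochoice.well_order le;
  la_mulr : forall p q r pr qr, psucc le p q ->
    concat p r = Some pr -> concat q r = Some qr -> psucc le pr qr;
  la_mull : forall p q s sp sq, psucc le p q ->
    concat s p = Some sp -> concat s q = Some sq -> psucc le sp sq;
  la_subpath : forall p q r t rq,
    concat r q = Some rq -> concat rq t = Some p -> le q p;
  la_length : forall p q, (plength q < plength p)%N -> psucc le p q }.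

End Order.

Section StrongKoszul.
Variables (K : fieldType) (Q : quiver) (le : rel (qpath Q)).
Local Notation KQ := (path_algebra K Q).
Implicit Types (x : KQ) (p : qpath Q) (I G X : set KQ).

Definition pvecs (S : set (qpath Q)) : set KQ := @pvec K Q @` S.

Definition is_tip x p : Prop :=
  p \in msupp x /\ forall q, q \in msupp x -> le q p.

(* Only nonzero elements have a tip. *)
Definition tips X : set (qpath Q) := [set p | exists2 x, X x & is_tip x p].

Definition uniform x : Prop :=
  x != 0 /\ exists v w, x = pvec K (vpath v) * x * pvec K (vpath w).

Definition homogeneous x : Prop :=
  exists d, forall p, p \in msupp x -> plength p = d.

Definition quadratic x : Prop := forall p, p \in msupp x -> plength p = 2.

Definition graded_ideal I : Prop :=
  is_ideal I /\ exists2 H, (forall h, H h -> homogeneous h) & I = ideal_gen H.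

Definition grobner_basis I G : Prop :=
  [/\ G `<=` I, forall g, G g -> homogeneous g /\ uniform g &
      ideal_gen (pvecs (tips G)) = ideal_gen (pvecs (tips I))].

(* The algebra KQ/I, together with its presentation, is given by I. *)
Definition strong_koszul I : Prop :=
  graded_ideal I /\
  exists2 G, grobner_basis I G & forall g, G g -> quadratic g.

End StrongKoszul.

Arguments pvecs K {Q} S.

Section GrAlg.
Variables (K : fieldType) (Q : quiver) (le : rel (qpath Q)).
Variable T : {set path2 Q}.
Local Notation KQ := (path_algebra K Q).

Definition Tpaths : set (qpath Q) := [set val t | t in [set` T]].

Definition normal_paths : set (qpath Q) :=
  ~` tips le (ideal_gen (pvecs K Tpaths)).

Definition N2 : {set path2 Q} := finset (fun n : path2 Q => val n \in normal_paths).

Definition N2t (t : path2 Q) : {set path2 Q} :=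
  finset (fun n : path2 Q => [&& n \in N2, psucc le (val t) (val n),
    start (val n) == start (val t) & finish (val n) == finish (val t)]).

(* The index set of the coordinates x_(t, n); see card_coord for its size D. *)
Definition coord : finType :=
  {tn : path2 Q * path2 Q | (tn.1 \in T) && (tn.2 \in N2t tn.1)}.

Definition apoint := {ffun coord -> K}.

Definition gelt (X : apoint) (t : path2 Q) : KQ :=
  pvec K (val t) -
  \sum_(i : coord | (val i).1 == t) X i *: pvec K (val (val i).2).

Definition gset (X : apoint) : set KQ := [set gelt X t | t in [set` T]].

Definition GrAlg : set apoint :=
  [set X | strong_koszul le (ideal_gen (gset X))].

Lemma card_coord : #|coord| = (\sum_(t in T) #|N2t t|)%N.
Proof.
rewrite card_sig -sum1_card.
under [RHS]eq_bigr do rewrite -sum1_card.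
by rewrite pair_big_dep /=; apply: eq_bigl => -[t n].
Qed.

End GrAlg.

Arguments GrAlg K {Q} le T.
Arguments apoint K {Q} le T.

(* Main.v *)
Require Import Defs.
From mathcomp Require Import all_boot all_order all_algebra finmap.
From mathcomp Require Import boolp classical_sets functions wochoice monalg.

Set Implicit Arguments.
Unset Strict Implicit.
Unset Printing Implicit Defensive.

Import GRing.Theory.

Local Open Scope classical_set_scope.
Local Open Scope ring_scope.

(** Write [g_t] for [gelt X t]: it is [t] minus a combination of paths [n] of
    length two that are not in [T], are parallel to [t] and are smaller than
    [t]. Two facts carry the theorem.

    The first concerns the ideals [<G(X)>]. Such an ideal has nothing in
    degrees 0 and 1, and its degree-two part is the span of the [g_t], because
    each [g_t] is quadratic and is fixed or killed by multiplication with a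
    vertex. As [t] is the only path of [T] occurring in [g_t], the coefficient
    of [g_t] in such a span can be read off: it is the coefficient of [t]
    ([ideal_gset_quadratic_part]). So a tip of length two of [<G(X)>] belongs
    to [T] ([ideal_gset_tip2]): a path [n] outside [T] occurs only together
    with some larger [t]. If [<G(X)>] has a quadratic Groebner basis, its tip
    ideal is therefore [<T>]. Moreover, if [<G(X)> = <G(Y)>] then the
    difference of the two elements with tip [t] has no coefficient on [T],
    hence it vanishes, and [X = Y].

    The second is the division algorithm ([division]), a well-founded
    induction on the tip which reduces an element modulo an ideal until no
    term is the tip of one of the available elements. If [I] is strong Koszul
    with tip ideal [<T>], a quadratic Groebner basis of [I] has the paths of
    [T] as tips. Each [t] in [T] is congruent modulo [I] to a combination of
    smaller parallel paths, and division turns it into a combination of paths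
    outside [T] ([reduced_tail]): these coefficients are the coordinates of
    a point [X] with [G(X)] inside [I]. As [<G(X)>] has all of [T] among its
    tips, the tips of [I] are tips of [<G(X)>] up to multiplication by paths,
    and a second division shows [I = <G(X)>] ([ideal_sub_of_tips]). *)

(** * Length admissible orders *)

Section PathOrder.
Variables (Q : quiver) (le : rel (qpath Q)).
Hypothesis hle : length_admissible le.
Implicit Types (p q r s t : qpath Q).

Lemma path_le_total : total le.
Proof. by move=> p q; apply: (wo_chainW (withinW (la_well_order hle))). Qed.

Lemma path_le_refl : reflexive le.
Proof. by move=> p; have /orP[] := path_le_total p p. Qed.

Lemma path_le_anti : antisymmetric le.
Proof.
by move=> p q; apply: (wo_chain_antisymmetric (withinW (la_well_order hle))).
Qed.

(** The least of the three paths settles every case. *)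
Lemma path_le_trans : transitive le.
Proof.
move=> q p r lpq lqr.
have [|m [[mA mmin] _]] := la_well_order hle (A := [pred x | x \in [:: p; q; r]]).
  by exists p; rewrite !inE eqxx.
have [lmp lmq lmr] : [/\ le m p, le m q & le m r].
  by split; apply: mmin; rewrite !inE eqxx ?orbT.
move: mA; rewrite !inE => /or3P[] /eqP em; subst m => //.
- by have <- : q = p by apply: path_le_anti; rewrite lmp.
- by have <- : q = r by apply: path_le_anti; rewrite lqr.
Qed.

Lemma psuccW p q : psucc le p q -> le q p.
Proof. by case/andP. Qed.

Lemma psucc_le_trans p q r : psucc le p q -> le r q -> psucc le p r.
Proof.
move=> /andP[npq lqp] lrq; rewrite /psucc (path_le_trans lrq lqp) andbT.
by apply: contraNneq npq => e; apply/eqP/path_le_anti; rewrite e lrq -e lqp.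
Qed.

Lemma psucc_irr p : psucc le p p = false.
Proof. by rewrite /psucc eqxx. Qed.

(** A well-order given by the minimum property supports induction: the least
    path violating [P] would contradict the induction step. *)
Lemma path_order_ind (P : qpath Q -> Prop) :
  (forall p, (forall q, psucc le p q -> P q) -> P p) -> forall p, P p.
Proof.
move=> step p; apply: contrapT => nPp.
have [|m [[mA mmin] _]] := la_well_order hle (A := [pred x | `[< ~ P x >]]).
  by exists p; apply/asboolP.
move/asboolP: mA; apply; apply: step => q smq.
apply: contrapT => nPq; have lmq : le m q by apply: mmin; apply/asboolP.
by have := psucc_le_trans smq lmq; rewrite psucc_irr.
Qed.

Lemma path_seq_max (ps : seq (qpath Q)) : ps != [::] ->
  exists2 p, p \in ps & forall q, q \in ps -> le q p.
Proof.
elim: ps => // p [|p' ps] IH _.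
  by exists p; rewrite ?mem_head // => q; rewrite !inE => /eqP ->; apply: path_le_refl.
have [//|m mps mmax] := IH _.
have /orP[lpm|lmp] := path_le_total p m.
  exists m; first by rewrite inE mps orbT.
  by move=> q; rewrite inE => /predU1P[-> //|/mmax].
exists p; first exact: mem_head.
move=> q; rewrite inE => /predU1P[->|/mmax lqm]; first exact: path_le_refl.
exact: path_le_trans lqm lmp.
Qed.

Lemma concat_le_mono r p q s rp rps rq rqs :
  concat r p = Some rp -> concat rp s = Some rps ->
  concat r q = Some rq -> concat rq s = Some rqs ->
  le q p -> le rqs rps.
Proof.
move=> e1 e2 e3 e4 lqp; have [epq|npq] := eqVneq p q.
  by move: e2 e4; rewrite -epq e1 in e3; case: e3 => -> -> [->]; apply: path_le_refl.
have spq : psucc le p q by rewrite /psucc npq.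
exact: psuccW (la_mulr hle (la_mull hle spq e1 e3) e2 e4).
Qed.

End PathOrder.

(** * Composition of paths and subpaths *)

Section Paths.
Variable Q : quiver.
Implicit Types (p q r s t : qpath Q) (S : set (qpath Q)).

Lemma plength_concat p q r : concat p q = Some r ->
  plength r = (plength p + plength q)%N.
Proof. by case/concat_SomeE => _ _ e; rewrite /plength e size_cat. Qed.

Lemma plength0_vpath p : plength p = 0%N -> p = vpath (start p).
Proof. by move/size0nil => e; apply: qpath_eq. Qed.

Lemma concat_injr q p p' r :
  concat q p = Some r -> concat q p' = Some r -> p = p'.
Proof.
move=> /concat_SomeE[e1 _ e2] /concat_SomeE[e3 _ e4].
apply: qpath_eq; first by rewrite -e1 -e3.
by move/eqP: e4; rewrite e2 eqseq_cat // eqxx => /eqP.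
Qed.

Lemma concat_injl q p p' r :
  concat p q = Some r -> concat p' q = Some r -> p = p'.
Proof.
move=> /concat_SomeE[_ e1 e2] /concat_SomeE[_ e3 e4].
apply: qpath_eq; first by rewrite -e1 -e3.
have es : size (arrows p) = size (arrows p').
  by apply/eqP; rewrite -(eqn_add2r (size (arrows q))) -!size_cat -e2 -e4.
by move/eqP: e4; rewrite e2 eqseq_cat // eqxx andbT => /eqP.
Qed.

Definition has_subpath_in S p : Prop :=
  exists s r t rs, [/\ S s, concat r s = Some rs & concat rs t = Some p].

Lemma has_subpath_self S s : S s -> has_subpath_in S s.
Proof.
move=> Ss; exists s, (vpath (start s)), (vpath (finish s)), s.
by rewrite concat_vl concat_vr !eqxx.
Qed.

Lemma has_subpath_concatl S q p r :
  concat q p = Some r -> has_subpath_in S p -> has_subpath_in S r.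
Proof.
move=> eqp [s [u [v [us [Ss eus ep]]]]].
have := concatA q us v; rewrite ep /= eqp.
case eq1: (concat q us) => [w|] //= /esym e1.
have := concatA q u s; rewrite eus /= eq1.
case: (concat q u) => [w'|] //= /esym e2.
by exists s, w', v, w.
Qed.

Lemma has_subpath_concatr S q p r :
  concat p q = Some r -> has_subpath_in S p -> has_subpath_in S r.
Proof.
move=> epq [s [u [v [us [Ss eus ep]]]]].
have := concatA us v q; rewrite ep /= epq.
case: (concat v q) => [w|] //= e1.
by exists s, u, w, us.
Qed.

(** A subpath as long as the whole path is the path itself: the two outer
    factors have length 0, so they are vertices. *)
Lemma has_subpath_same_length S n p :
  (forall s, S s -> plength s = n) -> plength p = n ->
  has_subpath_in S p -> S p.
Proof.
move=> lS lp [s [r [t [rs [Ss ers ep]]]]]; suff -> : p = s by [].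
have /eqP := plength_concat ep; rewrite (plength_concat ers) lp (lS _ Ss).
rewrite addnAC -[X in X == _]add0n eqn_add2r eq_sym addn_eq0.
move=> /andP[/eqP/plength0_vpath er /eqP/plength0_vpath et].
move: ers ep; rewrite er et concat_vl.
by case: ifP => // _ [<-]; rewrite concat_vr; case: ifP => // _ [].
Qed.

End Paths.

(** * Coefficients and supports in the path algebra *)

Section PathAlgebra.
Variables (K : fieldType) (Q : quiver).
Local Notation KQ := (path_algebra K Q).
Implicit Types (x y z g h : KQ) (p q r s t : qpath Q) (I J : set KQ).

Lemma coefD x y p : (x + y)@_p = x@_p + y@_p.
Proof. exact: mcoeffD. Qed.

Lemma coefB x y p : (x - y)@_p = x@_p - y@_p.
Proof. exact: mcoeffB. Qed.

Lemma coef0 p : (0 : KQ)@_p = 0.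
Proof. exact: mcoeff0. Qed.

Lemma coef_sum (A : Type) (l : seq A) (P : pred A) (F : A -> KQ) p :
  (\sum_(a <- l | P a) F a)@_p = \sum_(a <- l | P a) (F a)@_p.
Proof.
exact: (big_morph (fun x : KQ => x@_p) (fun x y => coefD x y p) (coef0 p)).
Qed.

Lemma supp_coef x p : (p \in msupp x) = (x@_p != 0).
Proof. by rewrite mcoeff_neq0. Qed.

Lemma supp_pvec p q : (q \in msupp (pvec K p)) = (q == p).
Proof.
by rewrite supp_coef pvecE (eq_sym p); case: (q == p); rewrite ?oner_eq0 ?eqxx.
Qed.

Lemma pvec_optE (o : option (qpath Q)) p :
  (pvec_opt K o)@_p = (o == Some p)%:R.
Proof. by case: o => [q|] /=; rewrite ?pvecE ?coef0. Qed.

Lemma coef_pvecMl q x r :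
  (pvec K q * x)@_r = \sum_(p <- msupp x) x@_p * (concat q p == Some r)%:R.
Proof.
rewrite [pvec K q * x]pamulEr coef_sum; apply: eq_bigr => p _.
by rewrite pacoeffZ pamul_pvec pvec_optE.
Qed.

Lemma coef_pvecMr q x r :
  (x * pvec K q)@_r = \sum_(p <- msupp x) x@_p * (concat p q == Some r)%:R.
Proof.
rewrite [x * pvec K q]pamulEl coef_sum; apply: eq_bigr => p _.
by rewrite pacoeffZ pamul_pvec pvec_optE.
Qed.

Lemma supp_pvecMl q x r : r \in msupp (pvec K q * x) ->
  exists2 p, p \in msupp x & concat q p = Some r.
Proof.
rewrite supp_coef => nz; apply: contrapT => nex; case/eqP: nz.
rewrite coef_pvecMl big_seq big1 // => p px.
by case: eqP => [e|_]; [case: nex; exists p | rewrite mulr0].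
Qed.

Lemma supp_pvecMr q x r : r \in msupp (x * pvec K q) ->
  exists2 p, p \in msupp x & concat p q = Some r.
Proof.
rewrite supp_coef => nz; apply: contrapT => nex; case/eqP: nz.
rewrite coef_pvecMr big_seq big1 // => p px.
by case: eqP => [e|_]; [case: nex; exists p | rewrite mulr0].
Qed.

Lemma coef_pvecMl_concat q x p r : concat q p = Some r ->
  (pvec K q * x)@_r = x@_p.
Proof.
move=> e; rewrite coef_pvecMl (eq_bigr (fun p' => if p' == p then x@_p else 0)).
  rewrite -big_mkcond; have [px|npx] := boolP (p \in msupp x).
    by rewrite -big_filter filter_pred1_uniq ?fset_uniq // big_seq1.
  by rewrite (mcoeff_outdom npx) big1_eq.
move=> p' _; case: (eqVneq p' p) => [->|np]; first by rewrite e eqxx mulr1.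
case: eqP => [e'|_]; last by rewrite mulr0.
by rewrite (concat_injr e' e) eqxx in np.
Qed.

Lemma coef_pvecMr_concat q x p r : concat p q = Some r ->
  (x * pvec K q)@_r = x@_p.
Proof.
move=> e; rewrite coef_pvecMr (eq_bigr (fun p' => if p' == p then x@_p else 0)).
  rewrite -big_mkcond; have [px|npx] := boolP (p \in msupp x).
    by rewrite -big_filter filter_pred1_uniq ?fset_uniq // big_seq1.
  by rewrite (mcoeff_outdom npx) big1_eq.
move=> p' _; case: (eqVneq p' p) => [->|np]; first by rewrite e eqxx mulr1.
case: eqP => [e'|_]; last by rewrite mulr0.
by rewrite (concat_injl e' e) eqxx in np.
Qed.

Lemma coef_vpathMl v x p :
  (pvec K (vpath v) * x)@_p = x@_p *+ (v == start p).
Proof.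
have [e|nv] := eqVneq v (start p).
  by apply: coef_pvecMl_concat; rewrite concat_vl e eqxx.
apply/eqP; apply: contraNT nv; rewrite -supp_coef => /supp_pvecMl[q _].
by rewrite concat_vl; case: eqP => // -> [->].
Qed.

Lemma coef_vpathMr v x p :
  (x * pvec K (vpath v))@_p = x@_p *+ (v == finish p).
Proof.
have [e|nv] := eqVneq v (finish p).
  by apply: coef_pvecMr_concat; rewrite concat_vr e eqxx.
apply/eqP; apply: contraNT nv; rewrite -supp_coef => /supp_pvecMr[q _].
by rewrite concat_vr; case: eqP => // -> [->].
Qed.

Lemma coef_pvecMl_low d r x q : (forall p, (plength p < d)%N -> x@_p = 0) ->
  (0 < plength r)%N -> (plength q <= d)%N -> (pvec K r * x)@_q = 0.
Proof.
move=> xlow r0 lq; apply: contrapT => /eqP; rewrite -supp_coef.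
move=> /supp_pvecMl[p px e]; move: px; rewrite supp_coef xlow ?eqxx //.
by apply: leq_trans lq; rewrite (plength_concat e) -add1n leq_add2r.
Qed.

Lemma coef_pvecMr_low d r x q : (forall p, (plength p < d)%N -> x@_p = 0) ->
  (0 < plength r)%N -> (plength q <= d)%N -> (x * pvec K r)@_q = 0.
Proof.
move=> xlow r0 lq; apply: contrapT => /eqP; rewrite -supp_coef.
move=> /supp_pvecMr[p px e]; move: px; rewrite supp_coef xlow ?eqxx //.
by apply: leq_trans lq; rewrite (plength_concat e) -addn1 leq_add2l.
Qed.

(** Multiplication by vertices on both sides selects the paths with prescribed
    endpoints. *)
Lemma uniform_parallel x p q : uniform x -> p \in msupp x -> q \in msupp x ->
  start p = start q /\ finish p = finish q.
Proof.
move=> [_ [v [w ex]]].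
have main r : r \in msupp x -> v = start r /\ w = finish r.
  rewrite ex => /supp_pvecMr[r' /supp_pvecMl[r'' _]].
  rewrite concat_vl concat_vr; case: eqP => // -> [->].
  by case: eqP => // -> [->].
by move=> /main[<- <-] /main[<- <-].
Qed.

Lemma idealZ I (c : K) x : is_ideal I -> I x -> I (c *: x).
Proof.
by move=> hI Ix; rewrite -[x]mul1r pascalerAl; apply: idealMl.
Qed.

Lemma idealB I x y : is_ideal I -> I x -> I y -> I (x - y).
Proof.
by move=> hI Ix Iy; apply: idealD => //; rewrite -scaleN1r; apply: idealZ.
Qed.

(** Every element is a linear combination of paths, so closure of a subspace
    under multiplication by arbitrary elements can be tested on paths. *)
Lemma is_ideal_of_paths I : I 0 -> (forall x y, I x -> I y -> I (x + y)) ->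
  (forall c x, I x -> I (c *: x)) ->
  (forall q x, I x -> I (pvec K q * x)) ->
  (forall q x, I x -> I (x * pvec K q)) -> is_ideal I.
Proof.
move=> I0 ID IZ Il Ir; split=> // a x Ix.
- rewrite [a * x]pamulEl; elim/big_ind: _ => // p _; apply: IZ; exact: Il.
- rewrite [x * a]pamulEr; elim/big_ind: _ => // p _; apply: IZ; exact: Ir.
Qed.

(** The elements all of whose terms have a subpath in [S] form an ideal, and it
    contains [S]. *)
Lemma monomial_ideal_supp (S : set (qpath Q)) x p :
  ideal_gen (pvecs K S) x -> p \in msupp x -> has_subpath_in S p.
Proof.
move=> hx.
suff: [set x : KQ | forall p, p \in msupp x -> has_subpath_in S p] x by apply.
apply: hx; split => /=; last first.
  by move=> _ [s Ss <-] q; rewrite supp_pvec => /eqP ->; apply: has_subpath_self.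
apply: is_ideal_of_paths => [q|y z hy hz q|c y hy q|q y hy r|q y hy r] /=.
- by rewrite supp_coef coef0 eqxx.
- have [/hy //|/mcoeff_outdom ey] := boolP (q \in msupp y).
  by rewrite supp_coef coefD ey add0r -supp_coef => /hz.
- rewrite supp_coef pacoeffZ mulf_eq0 negb_or => /andP[_ ny].
  by apply: hy; rewrite supp_coef.
- by move=> /supp_pvecMl[p' /hy hp' e]; apply: has_subpath_concatl e hp'.
- by move=> /supp_pvecMr[p' /hy hp' e]; apply: has_subpath_concatr e hp'.
Qed.

Lemma monomial_ideal_mono (S S' : set (qpath Q)) : S `<=` S' ->
  ideal_gen (pvecs K S) `<=` ideal_gen (pvecs K S').
Proof.
move=> sub; apply: smallest_sub; first exact: ideal_gen_ideal.
by move=> _ [s Ss <-]; apply: sub_gen_smallest; exists s => //; apply: sub.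
Qed.

End PathAlgebra.

(** * Division with respect to tips *)

Section Division.
Variables (K : fieldType) (Q : quiver) (le : rel (qpath Q)).
Hypothesis hle : length_admissible le.
Local Notation KQ := (path_algebra K Q).
Implicit Types (x y z g h : KQ) (p q r s t : qpath Q) (I : set KQ).

Lemma tip_exists x : x != 0 -> exists p, is_tip le x p.
Proof.
move=> nx; have [|p px pmax] := path_seq_max hle (ps := msupp x).
  apply: contraNneq nx => e; apply/eqP/malgP => p; rewrite coef0.
  by apply: mcoeff_outdom; rewrite -[_ \in _]/(p \in (msupp x : seq _)) e.
by exists p.
Qed.

(** The cancellation step of division: once the coefficients at [p] agree, only
    strictly smaller paths survive. *)
Lemma tip_cancel x g p c :
  (forall q, q \in msupp x -> le q p) -> (forall q, q \in msupp g -> le q p) ->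
  x@_p = c * g@_p ->
  forall q, q \in msupp (x - c *: g) ->
    psucc le p q /\ (q \in msupp x \/ q \in msupp g).
Proof.
move=> xp gp e q; rewrite supp_coef coefB pacoeffZ => nz.
have xg : q \in msupp x \/ q \in msupp g.
  have [qx|/mcoeff_outdom ex] := boolP (q \in msupp x); first by left.
  right; move: nz; rewrite ex sub0r oppr_eq0 mulf_eq0 negb_or => /andP[_].
  by rewrite supp_coef.
split=> //; rewrite /psucc; apply/andP; split; last by case: xg => [/xp|/gp].
by apply: contraNneq nz => <-; rewrite e subrr.
Qed.

Lemma tip_translate g t r rt s p : is_tip le g t ->
  concat r t = Some rt -> concat rt s = Some p ->
  is_tip le (pvec K r * g * pvec K s) p.
Proof.
move=> [tg gmax] e1 e2; split.
  by rewrite supp_coef (coef_pvecMr_concat _ e2) (coef_pvecMl_concat _ e1) -supp_coef.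
move=> q /supp_pvecMr[q' /supp_pvecMl[q'' q''g e3] e4].
exact: (concat_le_mono hle e1 e2 e3 e4 (gmax _ q''g)).
Qed.

(** The division algorithm. The set [B] confines the computation to a region
    stable under the available reductions; it is all paths when ideals are
    compared, and the paths smaller than and parallel to a given [t] when the
    tail of [t] is reduced. At the tip [p] of [x] one subtracts a multiple of
    an element of [I] with tip [p] if [p] is in [S], and moves the term at [p]
    to the remainder [y] otherwise; in both cases the new tip is smaller. *)
Lemma division I (B S : set (qpath Q)) : is_ideal I ->
  (forall p, S p -> B p ->
     exists g, [/\ I g, is_tip le g p & forall q, q \in msupp g -> B q]) ->
  forall x, (forall q, q \in msupp x -> B q) ->
  exists y, [/\ I (x - y), forall q, q \in msupp y -> B q &
                forall q, S q -> y@_q = 0].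
Proof.
move=> hI red x xB.
have [->|/tip_exists[p]] := eqVneq x 0.
  exists 0; rewrite subrr; split; first exact: ideal0.
    by move=> q; rewrite supp_coef coef0 eqxx.
  by move=> q _; rewrite coef0.
elim/(path_order_ind hle): p x xB => p IH x xB [px xmax].
have step g : p \in msupp g -> (forall q, q \in msupp g -> le q p) ->
    (forall q, q \in msupp g -> B q) ->
    exists c y, [/\ I (x - c *: g - y), forall q, q \in msupp y -> B q &
                 forall q, S q -> y@_q = 0].
  move=> pg gmax gB; pose c := x@_p / g@_p; exists c.
  have e : x@_p = c * g@_p by rewrite divfK // -supp_coef.
  have sub q := tip_cancel xmax gmax e (q := q).
  have [->|/tip_exists[q tq]] := eqVneq (x - c *: g) 0.
    exists 0; rewrite subrr; split; first exact: ideal0.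
      by move=> q; rewrite supp_coef coef0 eqxx.
    by move=> q _; rewrite coef0.
  apply: (IH q) => //; first by case: (sub q tq.1).
  by move=> q' /sub[_ [/xB|/gB]].
have Bp : B p by apply: xB.
have [Sp|nSp] := pselect (S p).
  have [g [Ig [pg gmax] gB]] := red p Sp Bp.
  have [c [y [Iy yB yS]]] := step g pg gmax gB.
  exists y; split=> //; rewrite -(subrK (c *: g) x) addrAC.
  by apply: idealD => //; apply: idealZ.
have supp1 q : q \in msupp (pvec K p) -> q = p by rewrite supp_pvec => /eqP.
have [||| c [y [Iy yB yS]]] := step (pvec K p).
- by rewrite supp_pvec eqxx.
- by move=> q /supp1 ->; apply: path_le_refl.
- by move=> q /supp1 ->.
exists (c *: pvec K p + y); split; first by rewrite opprD addrA.
  move=> q; rewrite supp_coef coefD pacoeffZ pvecE.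
  case: (eqVneq p q) => [<- //|_]; rewrite mulr0 add0r -supp_coef; exact: yB.
move=> q Sq; rewrite coefD pacoeffZ pvecE yS // addr0.
by case: eqP => [e|_]; [case: nSp; rewrite e | rewrite mulr0].
Qed.

(** The remainder on dividing an element of [I] by [J] stays in [I]; a nonzero
    one would have as tip a path that division has removed. *)
Lemma ideal_sub_of_tips I J : is_ideal I -> is_ideal J -> J `<=` I ->
  (forall p, tips le I p -> has_subpath_in (tips le J) p) -> I `<=` J.
Proof.
move=> hI hJ JI tIJ x Ix.
have [||y [Jxy _ yS]] := division (I := J) (B := setT)
    (S := has_subpath_in (tips le J)) hJ _ (x := x).
- move=> p [t [r [s [rt [[g Jg tg] e1 e2]]]]] _.
  exists (pvec K r * g * pvec K s); split=> //; last exact: tip_translate tg e1 e2.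
  by apply: Defs.idealMr => //; apply: idealMl.
- by [].
have Iy : I y by rewrite -(subKr x y); apply: idealB => //; apply: JI.
suff y0 : y = 0 by rewrite y0 subr0 in Jxy.
apply: contrapT => /eqP/tip_exists[p tp].
have Ip : tips le I p by exists y.
by have := tp.1; rewrite supp_coef (yS _ (tIJ _ Ip)) eqxx.
Qed.

End Division.

(** * The ideals generated by the families G(X) *)

Section QuadraticFamily.
Variables (K : fieldType) (Q : quiver) (le : rel (qpath Q)).
Hypothesis hle : length_admissible le.
Variable T : {set path2 Q}.
Local Notation KQ := (path_algebra K Q).
Implicit Types (X Y : apoint K le T) (x y z g h : KQ) (p q r : qpath Q).
Implicit Types (s t n : path2 Q).

Lemma plength_path2 t : plength (val t) = 2.
Proof. exact/eqP/(valP t). Qed.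

Lemma TpathsP t : Tpaths T (val t) -> t \in T.
Proof. by case=> s sT /val_inj <-. Qed.

Lemma Tpaths_length p : Tpaths T p -> plength p = 2.
Proof. by case=> t _ <-; apply: plength_path2. Qed.

(** A path of length two has a subpath in [T] only by being in [T]. *)
Lemma mem_N2 n : (n \in N2 K le T) = (n \notin T).
Proof.
rewrite inE; apply/idP/idP => [|nT]; last first.
  apply/mem_set => -[x hx [nx _]]; case/negP: nT; apply: TpathsP.
  apply: has_subpath_same_length (plength_path2 n) (monomial_ideal_supp hx nx).
  exact: Tpaths_length.
rewrite in_setE => nn; apply: contra_notN nn => nT; exists (pvec K (val n)).
  by apply: sub_gen_smallest; exists (val n) => //; exists n.
split=> [|q]; rewrite supp_pvec ?eqxx // => /eqP ->; exact: path_le_refl.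
Qed.

Lemma gelt_coef X t p : (gelt X t)@_p =
  (val t == p)%:R - \sum_(i | (val i).1 == t) X i * (val (val i).2 == p)%:R.
Proof.
rewrite coefB pvecE coef_sum; congr (_ - _).
by apply: eq_bigr => i _; rewrite pacoeffZ pvecE.
Qed.

Lemma coord_mem (i : Defs.coord K le T) :
  (val i).1 \in T /\ (val i).2 \in N2t K le T (val i).1.
Proof. exact/andP/(valP i). Qed.

Lemma gelt_coefT X s t : s \in T -> (gelt X t)@_(val s) = (t == s)%:R.
Proof.
move=> sT; rewrite gelt_coef big1 ?subr0 // => i _.
have [_] := coord_mem i; rewrite inE mem_N2 => /and4P[nT _ _ _].
case: eqP => [/val_inj e|_]; last by rewrite mulr0.
by rewrite e sT in nT.
Qed.

Lemma gelt_coef_coord X (i : Defs.coord K le T) :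
  (gelt X (val i).1)@_(val (val i).2) = - X i.
Proof.
have [tT] := coord_mem i; rewrite inE => /and4P[_ /andP[ntn _] _ _].
rewrite gelt_coef (negbTE ntn) sub0r (bigD1 i) //= eqxx mulr1 big1 ?addr0 //.
move=> j /andP[/eqP e1 nij]; case: eqP => [/val_inj e2|_]; last by rewrite mulr0.
case/eqP: nij; apply: val_inj.
by rewrite [LHS]surjective_pairing e1 e2 -surjective_pairing.
Qed.

Lemma gelt_supp X t p : p \in msupp (gelt X t) ->
  p = val t \/ exists2 n, n \in N2t K le T t & p = val n.
Proof.
rewrite supp_coef gelt_coef; have [->|ntp] := eqVneq (val t) p; first by left.
rewrite sub0r oppr_eq0 => nz; right; apply: contrapT => nex; case/eqP: nz.
rewrite big1 // => i /eqP eit; case: eqP => [e|_]; last by rewrite mulr0.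
by case: nex; exists (val i).2 => //; have [_] := coord_mem i; rewrite eit.
Qed.

Lemma gelt_supp_parallel X t p : p \in msupp (gelt X t) ->
  [/\ plength p = 2, le p (val t), start p = start (val t) &
      finish p = finish (val t)].
Proof.
case/gelt_supp => [->|[n]].
  by rewrite plength_path2 (path_le_refl hle).
rewrite inE => /and4P[_ /psuccW ltn /eqP es /eqP ef] ->.
by rewrite plength_path2.
Qed.

Lemma gelt_tip X t : t \in T -> is_tip le (gelt X t) (val t).
Proof.
move=> tT; split; first by rewrite supp_coef gelt_coefT // eqxx oner_eq0.
by move=> q /gelt_supp_parallel[].
Qed.

(** The elements satisfying these equations form an ideal containing every
    [g_t]. In degrees below two the equations say that the coefficients vanish.
    Multiplication by a path of positive length pushes everything beyond degree
    two, except what was in degrees below two and thus zero. Multiplication by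
    a vertex selects some of the equations, since all terms of [g_t] have the
    same endpoints. *)
Lemma ideal_gset_quadratic_part X x p :
  ideal_gen (gset X) x -> (plength p <= 2)%N ->
  x@_p = \sum_(t in T) x@_(val t) * (gelt X t)@_p.
Proof.
pose J : set KQ := [set x | forall p, (plength p <= 2)%N ->
  x@_p = \sum_(t in T) x@_(val t) * (gelt X t)@_p].
suff sub : ideal_gen (gset X) `<=` J by move=> /sub; apply.
have J_low y q : J y -> (plength q < 2)%N -> y@_q = 0.
  move=> Jy lq; rewrite Jy 1?ltnW // big1 // => t _.
  rewrite (@mcoeff_outdom _ _ (gelt X t)) ?mulr0 //.
  by apply: contraTN lq => /gelt_supp_parallel[-> _ _ _].
have J_of_low y : (forall q, (plength q <= 2)%N -> y@_q = 0) -> J y.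
  move=> y0 q lq; rewrite y0 // big1 // => t _.
  by rewrite y0 ?mul0r // plength_path2.
apply: smallest_sub; last first.
  move=> _ [t tT <-] q _; rewrite (bigD1 t) //= gelt_coefT // eqxx mul1r.
  rewrite big1 ?addr0 // => s /andP[sT nst].
  by rewrite gelt_coefT // eq_sym (negbTE nst) mul0r.
apply: is_ideal_of_paths => [q _|y z Jy Jz q lq|c y Jy q lq|r y Jy|r y Jy].
- by rewrite coef0 big1 // => t _; rewrite coef0 mul0r.
- rewrite coefD Jy // Jz // -big_split; apply: eq_bigr => t _.
  by rewrite (coefD y) mulrDl.
- rewrite pacoeffZ Jy // mulr_sumr; apply: eq_bigr => t _.
  by rewrite pacoeffZ mulrA.
- case: (posnP (plength r)) => [/plength0_vpath ->|r0]; last first.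
    by apply: J_of_low => q; apply: coef_pvecMl_low r0 => p'; apply: J_low.
  move=> q lq; rewrite coef_vpathMl Jy // -sumrMnl; apply: eq_bigr => t _.
  rewrite coef_vpathMl mulrnAl.
  have [/gelt_supp_parallel[_ _ -> _] //|] := boolP (q \in msupp (gelt X t)).
  by move/mcoeff_outdom ->; rewrite mulr0 !mul0rn.
- case: (posnP (plength r)) => [/plength0_vpath ->|r0]; last first.
    by apply: J_of_low => q; apply: coef_pvecMr_low r0 => p'; apply: J_low.
  move=> q lq; rewrite coef_vpathMr Jy // -sumrMnl; apply: eq_bigr => t _.
  rewrite coef_vpathMr mulrnAl.
  have [/gelt_supp_parallel[_ _ _ ->] //|] := boolP (q \in msupp (gelt X t)).
  by move/mcoeff_outdom ->; rewrite mulr0 !mul0rn.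
Qed.

(** If [p] is not in [T], it occurs in the quadratic part only through some
    [g_t] with [t] larger than [p]; then [t] itself occurs in [x], which
    contradicts maximality of the tip. *)
Lemma ideal_gset_tip2 X x p : ideal_gen (gset X) x -> is_tip le x p ->
  plength p = 2 -> Tpaths T p.
Proof.
move=> Ix [px xmax] lp; apply: contrapT => nTp.
have := px; rewrite supp_coef (ideal_gset_quadratic_part Ix) ?lp // big1 ?eqxx //.
move=> t tT; have [/gelt_supp[ep|[n]]|/mcoeff_outdom ->] := boolP (p \in msupp (gelt X t)).
- by case: nTp; rewrite ep; exists t.
- rewrite inE => /and4P[_ stn _ _] ep.
  have [/xmax lt|/mcoeff_outdom ->] := boolP (val t \in msupp x); last by rewrite mul0r.
  have := psucc_le_trans hle stn (r := val t).
  by rewrite -ep lt psucc_irr => /(_ isT).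
- by rewrite mulr0.
Qed.

(** The difference of the two elements with tip [t] lies in the common ideal and
    has no coefficient on [T], so its quadratic part vanishes. *)
Lemma ideal_gset_inj X Y :
  ideal_gen (gset X) = ideal_gen (gset Y) -> X = Y.
Proof.
move=> eXY; apply/ffunP => i; have [tT _] := coord_mem i.
apply: oppr_inj; rewrite -(gelt_coef_coord X i) -(gelt_coef_coord Y i).
move: (val i).1 (val (val i).2) (plength_path2 (val i).2) tT => t n ln tT.
have IX : ideal_gen (gset X) (gelt X t - gelt Y t).
  apply: (idealB (ideal_gen_ideal _)).
    by apply: sub_gen_smallest; exists t.
  by rewrite eXY; apply: sub_gen_smallest; exists t.
apply: subr0_eq; rewrite -(coefB (gelt X t) (gelt Y t)).
have ln2 : (plength n <= 2)%N by rewrite ln.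
rewrite (ideal_gset_quadratic_part IX ln2).
apply: big1 => s sT.
suff -> : (gelt X t - gelt Y t)@_(val s) = 0 by rewrite mul0r.
apply: etrans (coefB _ _ _) _; apply/eqP; rewrite subr_eq0; apply/eqP.
exact: etrans (gelt_coefT X t sT) (esym (gelt_coefT Y t sT)).
Qed.

(** The tips of a quadratic Groebner basis have length two, and the tips of
    length two of [<G(X)>] are the paths of [T]. *)
Lemma gset_tip_ideal X : strong_koszul le (ideal_gen (gset X)) ->
  ideal_gen (pvecs K (Tpaths T)) =
  ideal_gen (pvecs K (tips le (ideal_gen (gset X)))).
Proof.
case=> _ [G [GI _ eG] Gq]; apply/seteqP; split.
  apply: monomial_ideal_mono => _ [t tT <-]; exists (gelt X t).
    by apply: sub_gen_smallest; exists t.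
  exact: gelt_tip.
rewrite -eG; apply: monomial_ideal_mono => p [g Gg tg].
exact: ideal_gset_tip2 (GI _ Gg) tg (Gq _ Gg _ tg.1).
Qed.

(** This is [N2t] without the condition of lying outside [T]: the tail of
    a quadratic uniform element with tip [t] has only such paths, and division
    by the other tips then removes those in [T]. *)
Definition tail_paths t : set (qpath Q) :=
  [set p | [/\ plength p = 2, psucc le (val t) p,
               start p = start (val t) & finish p = finish (val t)]].

(** An element of the Groebner basis with tip [t], made monic, expresses [t] by
    smaller parallel paths modulo [I]; dividing by the other elements of the
    basis removes from this tail the paths of [T]. The bound [tail_paths] is
    preserved because the elements of the basis are quadratic and uniform. *)
Lemma reduced_tail I t : strong_koszul le I ->
  ideal_gen (pvecs K (Tpaths T)) = ideal_gen (pvecs K (tips le I)) ->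
  t \in T ->
  exists y, [/\ I (pvec K (val t) - y),
    forall p, p \in msupp y -> tail_paths t p &
    forall s, s \in T -> y@_(val s) = 0].
Proof.
case=> -[hI _] [G [GI Gu eG] Gq] eT tT.
have tG p : tips le G p -> plength p = 2 by case=> g /Gq gq [/gq].
have Tg s : s \in T -> exists2 g, G g & is_tip le g (val s).
  move=> sT; suff: tips le G (val s) by [].
  apply: has_subpath_same_length tG (plength_path2 s) _.
  apply: (@monomial_ideal_supp K _ _ (pvec K (val s))); last first.
    by rewrite supp_pvec eqxx.
  by rewrite eG -eT; apply: sub_gen_smallest; exists (val s) => //; exists s.
have Gpar g p q : G g -> is_tip le g p -> q \in msupp g ->
    [/\ plength q = 2, start q = start p & finish q = finish p].
  move=> Gg [pg _] qg; have [es ef] := uniform_parallel (Gu _ Gg).2 qg pg.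
  by split=> //; apply: Gq qg.
have [g Gg tg] := Tg t tT; pose c := (g@_(val t))^-1.
have [||y [Iy yB yS]] := division hle (I := I) (B := tail_paths t)
    (S := Tpaths T) hI _ (x := pvec K (val t) - c *: g).
- move=> _ [s sT <-] [_ sts es ef]; have [h Gh th] := Tg s sT.
  exists h; split=> //; first exact: GI.
  move=> q qh; have [lq eqs eqf] := Gpar _ _ _ Gh th qh.
  by split; rewrite ?eqs ?eqf //; apply: psucc_le_trans sts (th.2 _ qh).
- have supp1 q : q \in msupp (pvec K (val t)) -> q = val t.
    by rewrite supp_pvec => /eqP.
  have tmax q : q \in msupp (pvec K (val t)) -> le q (val t).
    by move=> /supp1 ->; apply: path_le_refl.
  have ec : (pvec K (val t))@_(val t) = c * g@_(val t).
    by rewrite pvecE eqxx mulVf // -supp_coef tg.1.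
  move=> q /(tip_cancel tmax tg.2 ec)[stq [/supp1 eq|qg]].
    by rewrite eq psucc_irr in stq.
  by have [lq es ef] := Gpar _ _ _ Gg tg qg.
exists y; split=> // [|s sT]; last by apply: yS; exists s.
rewrite -(subrK (c *: g) (pvec K (val t))) addrAC.
by apply: idealD => //; apply: idealZ => //; apply: GI.
Qed.

(** The tail paths of [t] outside [T] are exactly the members of [N2t], so the
    coefficients of the [f t] are the coordinates of a point. *)
Lemma gelt_of_tails (f : path2 Q -> KQ) :
  (forall t, t \in T -> (forall p, p \in msupp (f t) -> tail_paths t p) /\
                        (forall s, s \in T -> (f t)@_(val s) = 0)) ->
  exists X, forall t, t \in T -> gelt X t = pvec K (val t) - f t.
Proof.
move=> hf.
pose X : apoint K le T :=
  [ffun i : Defs.coord K le T => (f (val i).1)@_(val (val i).2)].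
exists X => t tT; have [fB fT] := hf t tT; apply/malgP => p.
rewrite (coefB _ (f t)) pvecE; have [<-|ntp] := eqVneq (val t) p.
  by rewrite gelt_coefT // eqxx fT // subr0.
rewrite sub0r.
have [[n nt ->]|nn] := pselect (exists2 n, n \in N2t K le T t & p = val n).
  have tn : ((t, n).1 \in T) && ((t, n).2 \in N2t K le T (t, n).1) by rewrite tT.
  have := gelt_coef_coord X (Sub (t, n) tn : Defs.coord K le T).
  by rewrite SubK ffunE SubK.
rewrite (@mcoeff_outdom _ _ (gelt X t)); last first.
  by apply/negP => /gelt_supp[e|//]; rewrite e eqxx in ntp.
rewrite mcoeff_outdom ?oppr0 //; apply/negP => pf.
have [/eqP lp stp es ef] := fB p pf; pose n : path2 Q := Sub p lp.
have en : p = val n by rewrite SubK.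
case: nn; exists n => //; rewrite inE mem_N2 -en stp es ef !eqxx !andbT.
by apply: contraTN pf => nT; rewrite supp_coef en fT // eqxx.
Qed.

Lemma gset_of_tip_ideal I : strong_koszul le I ->
  ideal_gen (pvecs K (Tpaths T)) = ideal_gen (pvecs K (tips le I)) ->
  exists X, ideal_gen (gset X) = I.
Proof.
move=> sI eT; have hI : is_ideal I by case: sI => -[].
have /boolp.choice[f fP] : forall t, exists y, t \in T ->
    [/\ I (pvec K (val t) - y), forall p, p \in msupp y -> tail_paths t p &
        forall s, s \in T -> y@_(val s) = 0].
  move=> t; have [tT|] := boolP (t \in T); last by exists 0.
  by have [y hy] := reduced_tail sI eT tT; exists y.
have [X gX] : exists X, forall t, t \in T -> gelt X t = pvec K (val t) - f t.
  by apply: gelt_of_tails => t /fP[].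
have XI : ideal_gen (gset X) `<=` I.
  apply: smallest_sub => // _ [t tT <-]; rewrite gX //.
  by case: (fP t tT).
exists X; apply/seteqP; split=> //.
apply: (ideal_sub_of_tips hle) => //; first exact: ideal_gen_ideal.
move=> p tp; apply: (@monomial_ideal_supp K _ _ (pvec K p)); last first.
  by rewrite supp_pvec eqxx.
have : ideal_gen (pvecs K (Tpaths T)) (pvec K p).
  by rewrite eT; apply: sub_gen_smallest; exists p.
apply: monomial_ideal_mono => _ [t tT <-]; exists (gelt X t).
  by apply: sub_gen_smallest; exists t.
exact: gelt_tip.
Qed.

End QuadraticFamily.

Theorem theorem3p4 (K : fieldType) (Q : quiver) (le : rel (qpath Q))
    (hle : length_admissible le) (T : {set path2 Q}) :
  set_bij (GrAlg K le T)
    [set I : set (path_algebra K Q) |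
       strong_koszul le I /\
       ideal_gen (pvecs K (Tpaths T)) = ideal_gen (pvecs K (tips le I))]
    (fun X : apoint K le T => ideal_gen (gset X)).
Proof.
split=> [X GX|X Y _ _|I [sI eI]].
- by split=> //; apply: gset_tip_ideal.
- exact: ideal_gset_inj.
- have [X eX] := gset_of_tip_ideal hle sI eI.
  by exists X => //; rewrite /GrAlg /= eX.
Qed.
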